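(* Let $G$ be a finitely generated group, with finite generating set $S=S^{-1}$, and let $d$ be the graph metric of the corresponding Cayley graph. Suppose there is some $n\in\mathbb{N}$ such that for all $m\in\mathbb{N}$ there is a rigid triple $\{x,y,z\}$ in the Cayley graph with $d(x,y)=n$ and perimeter $d(x,y)+d(y,z)+d(z,x)$ greater than $m$. Then there is a point of the metric boundary $\partial_d G$ which is not a Busemann point.
   Context: The Cayley graph of $G$ with respect to $S$ has vertex set $G$ and undirected edges joining $g$ and $gs$ for $g\in G$, $s\in S$. For a connected graph, the graph metric $d$ on the vertices is $d(x,y)=$ the minimum length (number of edges) of a path from $x$ to $y$; a minimal path from $x$ to $y$ is a path of length $d(x,y)$. A rigid triple is a set of $3$ vertices such that if $x$ is any one of these vertices, and $y$ and $z$ are the other two, then there are no minimal paths from $x$ to $y$ and from $x$ to $z$ which share a vertex other than $x$. Metric compactification: for a complete, locally compact metric space $(X,d)$, let $C_b(X)$ be the commutative unital C*-algebra of bounded continuous functions on $X$ with the uniform norm, and $C_\infty(X)$ the closed subalgebra of functions vanishing at infinity. For $y,z\in X$ let $\varphi_{y,z}(x)=d(x,y)-d(x,z)$, which lies in $C_b(X)$. Let $\mathcal{G}(X,d)$ be the closed (C*-)subalgebra of $C_b(X)$ generated by $C_\infty(X)$, the constant functions and all $\varphi_{y,z}$, $y,z\in X$. The metric compactification $\overline{X}_d$ is the maximal ideal space (Gelfand spectrum) of $\mathcal{G}(X,d)$; it is compact and contains $X$ as an open subset via point evaluations. The metric boundary is $\partial_d X=\overline{X}_d\setminus X$. Here it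 is applied to $X=G$ with the Cayley graph metric. Let $T$ be an unbounded subset of $\mathbb{R}^+=[0,\infty)$ containing $0$. A map $\gamma:T\to X$ is an almost-geodesic ray if for every $\varepsilon>0$ there is an integer $N$ such that $|d(\gamma(t),\gamma(s))+d(\gamma(s),\gamma(0))-t|<\varepsilon$ for all $t,s\in T$ with $t\ge s\ge N$. The ray $\gamma$ converges to $\omega\in\partial_d X$ if $\gamma(t)\to\omega$ in $\overline{X}_d$ as $t\to\infty$ in $T$. A point of $\partial_d X$ is a Busemann point if it is the limit of an almost-geodesic ray. *)

(* Defs.v *)
From HB Require Import structures.
From mathcomp Require Import all_boot all_order all_algebra finmap complex.
From mathcomp Require Import all_classical all_reals all_analysis.

Set Implicit Arguments.
Unset Strict Implicit.
Unset Printing Implicit Defensive.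

Import Order.TTheory GRing.Theory Num.Theory.
Import numFieldNormedType.Exports.

Local Open Scope classical_set_scope.
Local Open Scope ring_scope.

Record connected_graph := ConnectedGraph {
  vertex :> choiceType ;
  adj : rel vertex ;
  adj_sym : symmetric adj ;
  adj_conn : forall x y : vertex,
    exists p : seq vertex, path adj x p && (last x p == y) }.

Section GraphMetric.
Variable g : connected_graph.
Implicit Types (x y z : g) (p q : seq g).

(* p lists the vertices of the path after its origin x, so that [size p] is
   its number of edges. *)
Definition is_path x y p := path (@adj g) x p && (last x p == y).

Let is_length x y : pred nat :=
  fun k => `[< exists p, is_path x y p /\ size p = k >].

Fact length_exists x y : exists k, is_length x y k.
Proof. by have [p xpy] := adj_conn x y; exists (size p); apply/asboolP; exists p. Qed.

Definition gdist x y : nat := ex_minn (length_exists x y).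

Lemma gdist_path x y : exists2 p, is_path x y p & size p = gdist x y.
Proof. by rewrite /gdist; case: ex_minnP => m /asboolP[p [? ?]] _; exists p. Qed.

Lemma gdist_min x y p : is_path x y p -> (gdist x y <= size p)%N.
Proof.
rewrite /gdist; case: ex_minnP => m _ mmin xpy.
by apply: mmin; apply/asboolP; exists p.
Qed.

Definition minimal_path x y p := is_path x y p /\ size p = gdist x y.

Definition rigid_corner x y z := forall p q v,
  minimal_path x y p -> minimal_path x z q ->
  v \in x :: p -> v \in x :: q -> v = x.

Definition rigid_triple x y z :=
  [/\ uniq [:: x; y; z],
      rigid_corner x y z, rigid_corner y x z & rigid_corner z x y].

Definition perimeter x y z : nat := (gdist x y + gdist y z + gdist z x)%N.

Lemma gdistxx x : gdist x x = 0%N.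
Proof.
apply/eqP; rewrite -leqn0; have xx : is_path x x [::] by rewrite /is_path /=.
exact: (gdist_min xx).
Qed.

Lemma gdist_eq0 x y : gdist x y = 0%N -> x = y.
Proof.
by have [p /andP[_ /eqP <-] <-] := gdist_path x y => /size0nil ->.
Qed.

Lemma gdist_le_sym x y : (gdist x y <= gdist y x)%N.
Proof.
have [p /andP[yp /eqP px] <-] := gdist_path y x.
rewrite -(size_belast y p) -size_rev; apply: gdist_min; apply/andP; split.
  by rewrite -px rev_path (eq_path (e' := @adj g)) // => u v; rewrite adj_sym.
by case: p {yp} px => [<- //=|u p] _ /=; rewrite rev_cons last_rcons.
Qed.

Lemma gdist_sym x y : gdist x y = gdist y x.
Proof. by apply/eqP; rewrite eqn_leq !gdist_le_sym. Qed.

Lemma gdist_triangle y x z : (gdist x z <= gdist x y + gdist y z)%N.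
Proof.
have [p /andP[xp /eqP py] <-] := gdist_path x y.
have [q /andP[yq /eqP qz] <-] := gdist_path y z.
rewrite -size_cat; apply: gdist_min.
by rewrite /is_path cat_path last_cat py xp yq qz eqxx.
Qed.

End GraphMetric.

(* The vertex set as a metric space; R is part of the name because the metric
   takes values in R. *)
Definition graph_space (R : realType) (g : connected_graph) : Type := vertex g.

Section GraphSpace.
Variables (R : realType) (g : connected_graph).

Let dist (x y : graph_space R g) : R := (@gdist g x y)%:R.

Let distxx x : dist x x = 0. Proof. by rewrite /dist gdistxx. Qed.

Let dist_positivity x y : dist x y = 0 -> x = y.
Proof. by move/eqP; rewrite pnatr_eq0 => /eqP /gdist_eq0. Qed.

Let dist_sym x y : dist x y = dist y x.
Proof. by rewrite /dist gdist_sym. Qed.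

Let dist_triangle y x z : dist x z <= dist x y + dist y z.
Proof. by rewrite /dist -natrD ler_nat gdist_triangle. Qed.

HB.instance Definition _ := Choice.copy (graph_space R g) (vertex g).
HB.instance Definition _ := isMetric.Build R (graph_space R g)
  distxx dist_positivity dist_sym dist_triangle.

Lemma mdist_graph_spaceE (x y : graph_space R g) :
  mdist x y = (@gdist g x y)%:R.
Proof. by []. Qed.

End GraphSpace.

Definition generates (G : groupType) (S : {fset G}) :=
  forall H : {pred G}, group_closed H -> {subset S <= H} -> H =i predT.

Section Cayley.
Variables (G : groupType) (S : {fset G}).
Hypothesis Sinv : S = [fset (s^-1)%g | s in S]%fset.
Hypothesis Sgen : generates S.

Definition cayley_adj : rel G :=
  fun x y => y \in [fset (x * s)%g | s in S]%fset.

Fact cayley_adj_sym : symmetric cayley_adj.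
Proof.
suff adjW x y : cayley_adj x y -> cayley_adj y x.
  by move=> x y; apply/idP/idP; exact: adjW.
move=> /imfsetP[s /= sS ->]; apply/imfsetP; exists (s^-1)%g; last by rewrite mulgK.
by rewrite /= Sinv; apply/imfsetP; exists s.
Qed.

Lemma cayley_adjM a x y : cayley_adj x y -> cayley_adj (a * x)%g (a * y)%g.
Proof.
by move=> /imfsetP[s /= sS ->]; apply/imfsetP; exists s; rewrite ?mulgA.
Qed.

Fact cayley_adj_conn (x y : G) :
  exists p, path cayley_adj x p && (last x p == y).
Proof.
pose conn u v := exists p, path cayley_adj u p && (last u p == v).
have connT u v w : conn u v -> conn v w -> conn u w.
  move=> [p /andP[up /eqP pv]] [q /andP[vq /eqP qw]]; exists (p ++ q).
  by rewrite cat_path last_cat pv up vq qw eqxx.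
have connM a u v : conn u v -> conn (a * u)%g (a * v)%g.
  move=> [p /andP[up /eqP <-]]; exists ([seq (a * b)%g | b <- p]).
  rewrite last_map eqxx andbT path_map.
  by apply: sub_path up => b c; exact: cayley_adjM.
have connC u v : conn u v -> conn v u.
  move=> [p /andP[up /eqP pv]]; exists (rev (belast u p)).
  rewrite -pv rev_path (eq_path (e' := cayley_adj)); last first.
    by move=> b c; rewrite cayley_adj_sym.
  rewrite up /=; case: p {up} pv => [_ //=|b p] _ /=.
  by rewrite rev_cons last_rcons.
pose H : {pred G} := fun a => `[< conn 1%g a >].
have HH : group_closed H.
  split; first by apply/asboolP; exists [::]; rewrite /= eqxx.
  move=> a b /asboolP ca /asboolP cb; apply/asboolP.
  apply: connT ca _; rewrite -{1}[a](mulg1 a); apply: (connM a).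
  by apply: connC; have := connM (b^-1)%g _ _ cb; rewrite mulg1 mulVg.
have SH : {subset S <= H}.
  move=> s sS; apply/asboolP; exists [:: s]; rewrite /= eqxx !andbT.
  by apply/imfsetP; exists s; rewrite ?mul1g.
have /asboolP/(connM x) : H (x^-1 * y)%g by rewrite -[H _]/(_ \in H) Sgen.
by rewrite mulg1 mulgA mulgV mul1g.
Qed.

Definition cayley_graph : connected_graph :=
  ConnectedGraph cayley_adj_sym cayley_adj_conn.

End Cayley.

Section MetricAlgebra.
Variables (R : realType) (X : metricType R).
Local Notation C := (R[i]^o).

Definition bounded_continuous : set (X -> C) :=
  [set f | continuous f /\ bounded_fun f].

Definition vanishing_at_infinity : set (X -> C) :=
  [set f | continuous f /\ forall e : C, 0 < e ->
    exists2 K : set X, compact K & forall x, ~ K x -> `|f x| < e].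

Definition dist_diff (y z : X) : X -> C := fun x => (mdist x y - mdist x z)%:C%C.

(* The C*-subalgebras of the bounded continuous functions; on the latter the
   topology of the uniform norm is that of uniform convergence. *)
Record is_closed_star_subalgebra (A : set (X -> C)) : Prop := {
  csa_sub : A `<=` bounded_continuous ;
  csa_lin : forall (a : R[i]) (f h : X -> C), A f -> A h -> A (a *: f + h) ;
  csa_mul : forall f h, A f -> A h -> A (f * h) ;
  csa_conj : forall f, A f -> A (fun x => (f x)^*) ;
  csa_closed : closed (A : set {uniform X -> C}) }.

Definition metric_algebra : set (X -> C) :=
  smallest is_closed_star_subalgebra
    [set f | [\/ vanishing_at_infinity f,
                 exists c, f = cst c |
                 exists y z, f = dist_diff y z]].

Lemma metric_algebra_cst c : metric_algebra (cst c).
Proof. by move=> A [_]; apply; apply: Or32; exists c. Qed.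

Lemma metric_algebra_lin (a : R[i]) f h :
  metric_algebra f -> metric_algebra h -> metric_algebra (a *: f + h).
Proof.
by move=> mf mh A [HA gA]; apply: csa_lin => //; [exact: mf|exact: mh].
Qed.

Lemma metric_algebra_mul f h :
  metric_algebra f -> metric_algebra h -> metric_algebra (f * h).
Proof.
by move=> mf mh A [HA gA]; apply: csa_mul => //; [exact: mf|exact: mh].
Qed.

Fact metric_algebra_subring_closed :
  GRing.subring_closed (fun f : X -> C => f \in metric_algebra).
Proof.
split=> [|f h|f h]; rewrite -!topredE /=.
- by rewrite inE; exact: (metric_algebra_cst 1).
- rewrite !inE => mf mh; rewrite addrC -scaleN1r; exact: metric_algebra_lin.
- rewrite !inE; exact: metric_algebra_mul.
Qed.

Fact metric_algebra_submod_closed :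
  GRing.subsemimod_closed (fun f : X -> C => f \in metric_algebra).
Proof.
have m0 : metric_algebra 0 by exact: (metric_algebra_cst 0).
split=> [|a f]; rewrite -?topredE /=; last first.
  by rewrite -!topredE /= !inE => mf; rewrite -[a *: f]addr0; exact: metric_algebra_lin.
split=> [|f h]; rewrite -!topredE /= !inE //.
by move=> mf mh; rewrite -[f]scale1r; exact: metric_algebra_lin.
Qed.

Definition metric_alg : Type := set_type metric_algebra.

HB.instance Definition _ := SubChoice.on metric_alg.
HB.instance Definition _ :=
  GRing.SubChoice_isSubPzRing.Build _ _ metric_alg metric_algebra_subring_closed.
HB.instance Definition _ :=
  GRing.SubZmodule_isSubLmodule.Build _ _ _ metric_alg
    metric_algebra_submod_closed.

(* Points are the characters, i.e. the unital multiplicative linear functionals,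
   which correspond to the maximal ideals through their kernels; they carry the
   weak-* topology, induced below by the pointwise convergence of characters. *)
Record metric_compactification := Character {
  character :> {linear metric_alg -> C} ;
  character_mult : monoid_morphism character }.

HB.instance Definition _ := gen_eqMixin metric_compactification.
HB.instance Definition _ := gen_choiceMixin metric_compactification.

Definition character_fun (w : metric_compactification) : {ptws metric_alg -> C} :=
  fun f => w f.

HB.instance Definition _ := Topological.copy metric_compactification
  (initial_topology character_fun).

Definition eval_fun (x : X) (f : metric_alg) : C := val f x.

Fact eval_fun_linear x : linear (eval_fun x).
Proof. by []. Qed.

HB.instance Definition _ x :=
  GRing.isLinear.Build R[i] metric_alg C *:%R (eval_fun x) (eval_fun_linear x).

Fact eval_fun_mult x : monoid_morphism (eval_fun x).
Proof. by []. Qed.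

Definition point_eval (x : X) : metric_compactification :=
  @Character (eval_fun x) (eval_fun_mult x).

Definition metric_boundary : set metric_compactification := ~` range point_eval.

Definition ray_domain (T : set R) :=
  [/\ T `<=` [set t | 0 <= t], T 0 & ~ has_ubound T].

(* A map on T is represented by a total function whose values outside T are
   irrelevant. *)
Definition almost_geodesic_ray (T : set R) (ray : R -> X) :=
  ray_domain T /\
  forall e : R, 0 < e -> exists N : int, forall t s : R,
    T t -> T s -> s <= t -> N%:~R <= s ->
    `|mdist (ray t) (ray s) + mdist (ray s) (ray 0) - t| < e.

Definition ray_converges (T : set R) (ray : R -> X)
    (w : metric_compactification) :=
  point_eval (ray t) @[t --> within T +oo] --> w.

Definition Busemann_point (w : metric_compactification) :=
  metric_boundary w /\
  exists (T : set R) (ray : R -> X),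
    almost_geodesic_ray T ray /\ ray_converges T ray w.

End MetricAlgebra.

(* Main.v *)
Require Import Defs.
From HB Require Import structures.
From mathcomp Require Import all_boot all_order all_algebra finmap complex.
From mathcomp Require Import all_classical all_reals all_analysis.
From mathcomp Require Import zify ring lra.

Set Implicit Arguments.
Unset Strict Implicit.
Unset Printing Implicit Defensive.

Import Order.TTheory GRing.Theory Num.Theory.
Import numFieldNormedType.Exports.

Local Open Scope classical_set_scope.
Local Open Scope ring_scope.

(** Translating the triples by their first vertex and using that spheres of
    a Cayley graph are finite, one finds a vertex [y] and vertices [z]
    arbitrarily far from the identity [e] such that no vertex other than [z]
    lies both on a minimal path from [z] to [e] and on one from [z] to [y]
    ([rigid_corner_only_between], [sphere_finite]): this is the rigidity of the
    corners at [z].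

    Take an ultrafilter [U] refining the sets of such [z] outside larger and
    larger balls.  Functions of the metric algebra are bounded
    ([metric_algebra_bounded]), so they converge along [U], and the limit is a
    character [w].  The indicator function of a vertex vanishes at infinity and
    has limit 0 along [U], whereas the evaluation at that vertex gives it the
    value 1; hence [w] is a boundary point ([ultrafilter_character_boundary]).

    Suppose that an almost-geodesic ray converges to [w].  Distances are
    integers, so the ray is exactly geodesic from some time on, when seen from
    its origin ([almost_geodesic_ray_eventually]).  It is then also geodesic
    from some time on when seen from any other vertex
    ([eventually_geodesic_from]).  Choose a point [p] of the ray after which it
    is geodesic as seen from [e] and from [y].  For [u = e, y] the function
    [v |-> d(v, u) - d(v, p)] is eventually constant along the ray, equal to
    [d(u, p)], so this is its value at [w].  Its limit along [U] is the same,
    and by integrality [d(z, u) = d(z, p) + d(p, u)] for [U]-many [z]: the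
    vertex [p] lies on minimal paths from [z] to [e] and from [z] to [y].  This
    forces [z = p], although [U]-many [z] differ from [p]
    ([separating_ultrafilter_not_Busemann]). *)

(** * Minimal paths and geodesic rays in a connected graph *)

Section GraphDistances.
Variable g : connected_graph.
Implicit Types x y z p : g.

(** The form of a rigid corner used below: it speaks of distances only, hence
    is visibly invariant under isometries and can be read off from limits of
    differences of distances. *)
Definition only_between_at z x y := forall p,
  (gdist z x = gdist z p + gdist p x)%N ->
  (gdist z y = gdist z p + gdist p y)%N -> p = z.

(** Concatenating a minimal path from [z] to [p] with minimal paths from [p] to
    [x] and to [y] gives two minimal paths through [p]. *)
Lemma rigid_corner_only_between z x y :
  rigid_corner z x y -> only_between_at z x y.
Proof.
move=> rig p zpx zpy.
have [a /andP[za /eqP ap] sa] := gdist_path z p.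
have cat_min u : (gdist z u = gdist z p + gdist p u)%N ->
    exists b, minimal_path z u (a ++ b).
  have [b /andP[pb bu] <-] := gdist_path p u => zpu; exists b; split.
    by rewrite /is_path cat_path last_cat ap za pb.
  by rewrite size_cat sa.
have [b zb] := cat_min _ zpx; have [c zc] := cat_min _ zpy.
have pa d : p \in z :: a ++ d by rewrite -cat_cons mem_cat -ap mem_last.
exact: rig zb zc (pa b) (pa c).
Qed.

(** Along a ray geodesic from [o], the quantity
    [d(x, o) + d(x, ray s) - d(o, ray s)] is a natural number by the triangle
    inequality, and it does not increase with [s]; so it is eventually constant,
    which means that the ray is eventually geodesic from [x] too. *)
Lemma eventually_geodesic_from (R : realType) (D : set R) (ray : R -> g) o :
    D !=set0 ->
    (forall s t, D s -> D t -> s <= t ->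
      (gdist o (ray t) = gdist o (ray s) + gdist (ray s) (ray t))%N) ->
  forall x, exists2 a, D a & forall s t, D s -> D t -> a <= s -> s <= t ->
    (gdist x (ray t) = gdist x (ray s) + gdist (ray s) (ray t))%N.
Proof.
move=> [s0 Ds0] geo x.
pose E s := (gdist x o + gdist x (ray s) - gdist o (ray s))%N.
have Eval s : (E s + gdist o (ray s) = gdist x o + gdist x (ray s))%N.
  have := gdist_triangle x o (ray s); rewrite (gdist_sym o x) /E; lia.
have Ehomo s t : D s -> D t -> s <= t -> (E t <= E s)%N.
  move=> Ds Dt st; have := geo _ _ Ds Dt st; have := Eval s; have := Eval t.
  have := gdist_triangle (ray s) x (ray t); lia.
have exE : exists k, `[< exists2 s, D s & E s = k >].
  by exists (E s0); apply/asboolP; exists s0.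
case: (ex_minnP exE) => k /asboolP[a Da Ea] kmin.
have Econst s : D s -> a <= s -> E s = k.
  move=> Ds as_; apply/eqP; rewrite eqn_leq -{1}Ea Ehomo //=.
  by apply: kmin; apply/asboolP; exists s.
exists a => // s t Ds Dt as_ st; have := geo _ _ Ds Dt st.
have := Eval s; have := Eval t.
rewrite !Econst //; first lia.
exact: le_trans as_ st.
Qed.

End GraphDistances.

(** * Translations and spheres in Cayley graphs *)

Section CayleyDistances.
Variables (G : groupType) (S : {fset G}).
Variables (Sinv : S = [fset (s^-1)%g | s in S]%fset) (Sgen : generates S).
Local Notation Gamma := (cayley_graph Sinv Sgen).

Lemma gdist_mulg (a x y : Gamma) :
  gdist ((a * x)%g : Gamma) ((a * y)%g : Gamma) = gdist x y.
Proof.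
have le (b u v : Gamma) :
    (gdist ((b * u)%g : Gamma) ((b * v)%g : Gamma) <= gdist u v)%N.
  have [p /andP[up /eqP pv] <-] := gdist_path u v.
  rewrite -(size_map (fun c : G => (b * c)%g : G)); apply: gdist_min.
  apply/andP; split; last by rewrite last_map pv.
  by rewrite path_map; apply: sub_path up => c d; exact: cayley_adjM.
apply/eqP; rewrite eqn_leq le.
by have := le (a^-1)%g (a * x)%g (a * y)%g; rewrite !mulKg.
Qed.

Lemma only_between_at_mulg (a x y z : Gamma) : only_between_at z x y ->
  @only_between_at Gamma (a * z)%g (a * x)%g (a * y)%g.
Proof.
move=> zxy p; rewrite -{1 2 3 4}[p](mulVKg a) !gdist_mulg => zpx zpy.
by rewrite -(zxy _ zpx zpy) mulVKg.
Qed.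

Lemma sphere_finite (n : nat) : exists s : seq G,
  forall y : Gamma, gdist (1%g : Gamma) y = n -> y \in s.
Proof.
suff [s sP] : exists s : seq G, forall p : seq G, size p = n ->
    path (cayley_adj S) 1%g p -> last 1%g p \in s.
  exists s => y; have [p /andP[xp /eqP <-] sp] := gdist_path (1%g : Gamma) y.
  by rewrite -sp => /sP; apply.
elim: n => [|n [s sP]]; first by exists [:: 1%g] => -[|//] _ _ /=; rewrite inE.
exists [seq (a * b)%g | a <- s, b <- S] => p.
case/lastP: p => [//|p b]; rewrite size_rcons => -[sp].
rewrite rcons_path last_rcons => /andP[/(sP _ sp) ps] /imfsetP[c /= cS ->].
by apply/allpairsP; exists (last 1%g p, c).
Qed.

End CayleyDistances.

(** * Limits of bounded complex functions along an ultrafilter *)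

Section ComplexLimits.
Variable R : realType.
Local Notation C := (R[i]^o).

Lemma complex_gt0P (e : R[i]) : 0 < e -> exists2 r : R, 0 < r & e = r%:C%C.
Proof.
case: e => r i; rewrite ltcE /= => /andP[/eqP i0 r0].
by exists r; rewrite // i0.
Qed.

Lemma norm_real_complex (r : R) : `|(r%:C)%C : R[i]| = (`|r|%:C)%C.
Proof. by rewrite normc_def /= expr0n addr0 sqrtr_sqr. Qed.

Lemma real_complex_cvg (T : Type) (F : set_system T) (FF : Filter F)
    (f : T -> R) (l : R) :
  f x @[x --> F] --> l -> (((f x)%:C)%C : C) @[x --> F] --> ((l%:C)%C : C).
Proof.
move=> fl; apply/cvgrPdist_lt => _ /complex_gt0P[r r0 ->].
move/cvgrPdist_lt: fl => /(_ _ r0); apply: filterS => x.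
by rewrite -rmorphB /= norm_real_complex ltcR.
Qed.

(** The values stay in the compact interval between [- M] and [M]. *)
Lemma ultrafilter_real_cvg (T : Type) (U : set_system T) (f : T -> R) (M : R) :
  UltraFilter U -> (forall x, `|f x| <= M) ->
  exists l : R, f x @[x --> U] --> l.
Proof.
move=> UU fM.
have [G [GU fG]] := @ultraFilterLemma R (f @ U) _.
have : G `[- M, M]%classic.
  apply: fG; apply: (@filterS _ U _ setT) filterT => x _ /=.
  by have := fM x; rewrite ler_norml in_itv.
have := @segment_compact R (- M) M; rewrite compact_ultra => /(_ _ GU)/[apply].
move=> [l [_ Gl]]; exists l => A lA.
(* [G] refines the image of [U], hence equals it by maximality of [U]. *)
have [//|UnA] := in_ultra_setVsetC (f @^-1` A) UU.
have /filter_ex[y [yA ynA]] : G (A `&` ~` A).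
  by apply: filterI; [exact: Gl|exact: fG].
by case: ynA.
Qed.

Lemma ultrafilter_cvg (T : Type) (U : set_system T) (f : T -> C) (M : C) :
  UltraFilter U -> (forall x, `|f x| <= M) -> cvg (f x @[x --> U]).
Proof.
move=> UU fM.
have normReIm x : `|complex.Re (f x)| <= complex.Re M /\
    `|complex.Im (f x)| <= complex.Re M.
  have := fM x; rewrite normc_def lecE /= => /andP[_ leM].
  split; apply: le_trans leM; rewrite -sqrtr_sqr ler_wsqrtr //.
    by rewrite lerDl sqr_ge0.
  by rewrite lerDr sqr_ge0.
have [a fa] := ultrafilter_real_cvg UU (fun x => (normReIm x).1).
have [b fb] := ultrafilter_real_cvg UU (fun x => (normReIm x).2).
apply/cvg_ex; exists ((a%:C)%C + 'i%C * (b%:C)%C : C).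
rewrite (_ : f = fun x => ((complex.Re (f x))%:C)%C
    + 'i%C * ((complex.Im (f x))%:C)%C :> C); last first.
  by apply/funext => x; exact: complexE.
apply: cvgD; first exact: real_complex_cvg.
apply: cvgM; first exact: cvg_cst.
exact: real_complex_cvg.
Qed.

End ComplexLimits.

(** * Elements of the metric algebra are bounded *)

Section MetricAlgebraTheory.
Variables (R : realType) (X : metricType R).
Local Notation C := (R[i]^o).

Lemma bounded_fun_normP (f : X -> C) :
  bounded_fun f <-> exists2 M : C, 0 < M & forall x, `|f x| <= M.
Proof.
split=> [/pinfty_ex_gt0[M M0 fM]|[M M0 fM]].
  by exists M => // x; exact: fM.
exists M; split=> [|N MN x _ /=]; first exact: gtr0_real.
exact: le_trans (fM x) (ltW MN).
Qed.

Lemma conjC_continuous : continuous (fun z : C => z^* : C).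
Proof.
move=> z; apply/(@cvgrPdist_lt _ _ _ _ (nbhs_filter (z : C))) => e e0.
apply/nbhs_ballP; exists e => // w.
by rewrite -ball_normE /= -rmorphB norm_conjC.
Qed.

Lemma Re_norm_continuous : continuous (fun z : C => complex.Re `|z| : R).
Proof.
move=> z; apply/(@cvgrPdist_lt _ _ _ _ (nbhs_filter (z : C))) => e e0.
apply/nbhs_ballP; exists (e%:C)%C; first by rewrite /= ltcR.
move=> w; rewrite -ball_normE /= => /(le_lt_trans (ler_dist_dist _ _)).
rewrite !normc_def /= subrr expr0n addr0 sqrtr_sqr ltcR.
by case: z => ? ?; case: w.
Qed.

Lemma mdist_diff_le (x y z : X) : `|mdist x y - mdist x z| <= mdist y z.
Proof.
have := metric_triangle x y z; have := metric_triangle x z y.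
rewrite (metric_sym z y) => xzy xyz; rewrite ler_norml; lra.
Qed.

Lemma dist_diff_continuous (y z : X) : continuous (dist_diff y z : X -> C).
Proof.
have mcont u : continuous (fun x : X => mdist x u : R).
  move=> x; apply/cvgrPdist_lt => e e0.
  have : ball x e `<=` [set t | `|mdist x u - mdist t u| < e].
    move=> t; rewrite ballEmdist /= => xt; apply: le_lt_trans xt.
    by rewrite (metric_sym x u) (metric_sym t u); exact: mdist_diff_le.
  by move=> /filterS; apply; exact: nbhsx_ballx.
move=> x; apply: real_complex_cvg.
by apply: cvgB; exact: mcont.
Qed.

(** On a compact set outside which the function has modulus less than 1, the
    bound comes from the continuous image being compact. *)
Lemma vanishing_bounded (f : X -> C) :
  vanishing_at_infinity f -> bounded_fun f.
Proof.
move=> [fcont fvan]; have [K Kc fK] := fvan 1 ltr01.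
have nf_cont : continuous (fun x => complex.Re `|f x| : R).
  move=> x; apply: (@cvg_comp _ _ _ f (fun z : C => complex.Re `|z|)).
    exact: fcont.
  exact: Re_norm_continuous.
have := @continuous_compact _ _ _ K (continuous_subspaceT nf_cont) Kc.
move=> /compact_bounded [M [_ KM]].
pose N := Num.max 1 (`|M| + 1).
have N1 : 1 <= N by rewrite le_max lexx.
apply/bounded_fun_normP; exists (N%:C)%C => [|x].
  by rewrite ltcR (lt_le_trans ltr01).
have [Kx|/fK/ltW f1] := pselect (K x); last first.
  by apply: le_trans f1 _; rewrite -[1]/((1%:C)%C) lecR.
have MN : M < N.
  rewrite lt_max; apply/orP; right.
  by apply: le_lt_trans (ler_norm M) _; rewrite ltrDl.
have := KM N MN (complex.Re `|f x|) (ex_intro2 _ _ x Kx erefl).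
by rewrite normc_def /= ger0_norm ?sqrtr_ge0 // lecR.
Qed.

(** A uniform limit of continuous functions is continuous, and a function at
    uniform distance at most 1 from a bounded one is bounded. *)
Lemma bounded_continuous_closed :
  closed (@bounded_continuous R X : set {uniform X -> C}).
Proof.
move=> f clf.
pose near_f (e : C) := [set h : X -> C | forall x, `|f x - h x| < e].
have nearP e : 0 < e -> nbhs (f : {uniform X -> C}) (near_f e).
  move=> e0; apply/uniform_nbhs; exists [set p | ball p.1 e p.2].
  split; first exact: entourage_ball (PosNum e0).
  by move=> h fh x; have := fh x I; rewrite /= -ball_normE.
split.
  have PF : ProperFilter (within (@bounded_continuous R X)
      (nbhs (f : {uniform X -> C}))).
    apply: Build_ProperFilter_ex => A /clf[h [hbc Ah]]; exists h.
    exact: Ah.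
  apply: (@uniform_limit_continuous _ _ (within (@bounded_continuous R X)
    (nbhs (f : {uniform X -> C}))) f PF).
    apply: (@filterS _ (nbhs (f : {uniform X -> C})) _ setT) filterT.
    by move=> h _ [].
  by move=> A; apply: (@filterS _ (nbhs (f : {uniform X -> C})) _ A) => h.
have [h [[_ /bounded_fun_normP[M M0 hM]] fh]] := clf _ (nearP 1 ltr01).
apply/bounded_fun_normP; exists (1 + M) => [|x]; first exact: addr_gt0.
rewrite -[f x](subrK (h x)); apply: le_trans (ler_normD _ _) _.
by rewrite lerD // ltW // fh.
Qed.

Lemma bounded_continuous_csa :
  is_closed_star_subalgebra (@bounded_continuous R X).
Proof.
split=> //.
- move=> a f h [fc /bounded_fun_normP[M M0 fM]].
  move=> [hc /bounded_fun_normP[N N0 hN]]; split=> [x|].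
    apply: cvgD; last exact: hc.
    by apply: cvgM; [exact: cvg_cst|exact: fc].
  apply/bounded_fun_normP; exists (`|a| * M + N) => [|x].
    by rewrite ltr_wpDl // mulr_ge0 // ltW.
  apply: le_trans (ler_normD _ _) _.
  by rewrite lerD // normrM ler_wpM2l.
- move=> f h [fc /bounded_fun_normP[M M0 fM]] [hc /bounded_fun_normP[N N0 hN]].
  split=> [x|]; first by apply: cvgM; [exact: fc|exact: hc].
  apply/bounded_fun_normP; exists (M * N) => [|x]; first exact: mulr_gt0.
  by rewrite normrM ler_pM.
- move=> f [fc /bounded_fun_normP[M M0 fM]]; split=> [x|].
    apply: (@cvg_comp _ _ _ f (fun z : C => z^* : C)); first exact: fc.
    exact: conjC_continuous.
  by apply/bounded_fun_normP; exists M => // x; rewrite norm_conjC.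
- exact: bounded_continuous_closed.
Qed.

(** The metric algebra is an intersection of closed subalgebras; that its
    elements are bounded thus needs one such subalgebra of bounded functions
    containing the generators, namely that of all bounded continuous
    functions. *)
Lemma metric_algebra_bounded (f : X -> C) :
  metric_algebra f -> exists2 M : C, 0 < M & forall x, `|f x| <= M.
Proof.
move=> /(_ (@bounded_continuous R X)); case=> [|_ /bounded_fun_normP//].
split=> [|h [hv|[c ->]|[y [z ->]]]]; first exact: bounded_continuous_csa.
- by split; [exact: hv.1|exact: vanishing_bounded].
- split=> [x|]; first exact: cvg_cst.
  apply/bounded_fun_normP; exists (1 + `|c|) => [|x]; last by rewrite lerDr.
  by rewrite ltr_pwDl.
- split; first exact: dist_diff_continuous.
  apply/bounded_fun_normP; exists ((1 + mdist y z)%:C)%C => [|x].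
    by rewrite ltcR ltr_pwDl // mdist_ge0.
  rewrite /dist_diff norm_real_complex lecR.
  by apply: le_trans (mdist_diff_le _ _ _) _; rewrite lerDr.
Qed.

End MetricAlgebraTheory.

(** * The character of an ultrafilter, and limits of rays *)

Section UltrafilterCharacter.
Variables (R : realType) (X : metricType R) (U : set_system X).
Hypothesis UU : UltraFilter U.
Local Notation C := (R[i]^o).

Lemma metric_alg_cvg (f : metric_alg X) : cvg ((\val f x : C) @[x --> U]).
Proof.
have [M _ fM] := metric_algebra_bounded (set_valP f).
exact: ultrafilter_cvg UU fM.
Qed.

Definition ultrafilter_limit (f : metric_alg X) : C :=
  lim ((\val f x : C) @[x --> U]).

Fact ultrafilter_limit_linear : linear ultrafilter_limit.
Proof.
move=> a f h; apply: norm_cvg_lim; apply: cvgD; last exact: metric_alg_cvg.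
by apply: cvgM; [exact: cvg_cst|exact: metric_alg_cvg].
Qed.

HB.instance Definition _ :=
  GRing.isLinear.Build R[i] (metric_alg X) C *:%R ultrafilter_limit
    ultrafilter_limit_linear.

Fact ultrafilter_limit_mult : monoid_morphism ultrafilter_limit.
Proof.
split; first by apply: norm_cvg_lim; exact: cvg_cst.
move=> f h; apply: norm_cvg_lim.
by apply: cvgM; exact: metric_alg_cvg.
Qed.

Definition ultrafilter_character : metric_compactification X :=
  @Character _ _ ultrafilter_limit ultrafilter_limit_mult.

Lemma ultrafilter_character_cvg (f : metric_alg X) :
  (\val f x : C) @[x --> U] --> (ultrafilter_character f : C).
Proof. exact: metric_alg_cvg. Qed.

End UltrafilterCharacter.

Section RayLimits.
Variables (R : realType) (X : metricType R).
Local Notation C := (R[i]^o).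

Lemma ray_domain_proper (T : set R) :
  ray_domain T -> ProperFilter (within T +oo).
Proof.
move=> [T0 _ Tunb]; apply: Build_ProperFilter_ex => A [M [Mreal MA]].
apply/not_existsP => noA; apply: Tunb; exists M => t Tt.
rewrite leNgt; apply/negP => Mt; apply: (noA t).
exact: MA Mt Tt.
Qed.

Lemma ray_converges_cvg (T : set R) (ray : R -> X)
    (w : metric_compactification X) (f : metric_alg X) :
  ray_converges T ray w -> ray_domain T ->
  (\val f (ray t) : C) @[t --> within T +oo] --> (w f : C).
Proof.
move=> cvw /ray_domain_proper PF.
have cw : continuous (fun v : metric_compactification X => v f : C).
  move=> v; apply: (@cvg_comp _ _ _ (@character_fun R X)
    (fun h : {ptws metric_alg X -> C} => h f)).
    exact: initial_continuous.
  exact: (@proj_continuous (metric_alg X) (fun=> C) f (character_fun v)).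
exact: cvg_comp cvw (cw w).
Qed.

End RayLimits.

(** * Non-Busemann boundary points of graphs *)

Lemma eq_nat_dist_lt1 (K : numDomainType) (a b : nat) :
  `|a%:R - b%:R : K| < 1 -> a = b.
Proof. rewrite !pmulrn -intrB -intr_norm ltrz1; lia. Qed.

Section GraphBoundary.
Variables (R : realType) (g : connected_graph).
Local Notation X := (graph_space R g).
Local Notation C := (R[i]^o).

Definition delta_fun (u : X) : X -> C := fun v => (v == u)%:R.

(** The unit balls of a graph are singletons, which makes the indicator
    function of a vertex continuous. *)
Lemma delta_fun_vanishing (u : X) : vanishing_at_infinity (delta_fun u).
Proof.
split=> [v|e e0]; last first.
  exists [set u] => [|v /eqP/negbTE vu]; first exact: compact_set1.
  by rewrite /delta_fun vu normr0.
apply: (@cvg_near_cst _ _ _ _ (nbhs v) (nbhs_filter v)).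
apply: filterS (nbhsx_ballx v 1 ltr01) => v'.
rewrite ballEmdist /= mdist_graph_spaceE ltrn1 ltnS leqn0.
by move=> /eqP/gdist_eq0 ->.
Qed.

Lemma delta_fun_alg (u : X) : delta_fun u \in @metric_algebra R X.
Proof.
by rewrite inE => A [_]; apply; apply: Or31; exact: delta_fun_vanishing.
Qed.

Lemma dist_diff_alg (y z : X) : dist_diff y z \in @metric_algebra R X.
Proof. by rewrite inE => A [_]; apply; apply: Or33; exists y, z. Qed.

Lemma ultrafilter_character_boundary (U : set_system X) (UU : UltraFilter U) :
  (forall u, U [set v | v != u]) -> metric_boundary (ultrafilter_character UU).
Proof.
move=> Ufree [u _ wu]; pose f : metric_alg X := SigSub (delta_fun_alg u).
have : ultrafilter_character UU f = 0.
  apply: norm_cvg_lim; apply: cvg_near_cst.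
  by apply: filterS (Ufree u) => v /negbTE vu; rewrite /= /delta_fun vu.
by rewrite -wu /= /eval_fun /= /delta_fun eqxx => /eqP; rewrite oner_eq0.
Qed.

(** With [e = 1/2], the lengths [d(ray t, ray s) + d(ray s, ray 0)] and
    [d(ray t, ray 0)] (the case [s = t]) are integers both at distance less
    than 1/2 from [t], so they agree. *)
Lemma almost_geodesic_ray_eventually (T : set R) (ray : R -> X) :
  almost_geodesic_ray T ray ->
  exists2 a : R, T a & forall s t, T s -> T t -> a <= s -> s <= t ->
    (@gdist g (ray 0%R) (ray t) =
      gdist (ray 0%R) (ray s) + @gdist g (ray s) (ray t))%N.
Proof.
move=> [[T0 _ Tunb] /(_ 2^-1) []]; first by rewrite invr_gt0.
move=> N Nray.
have [a Ta Na] : exists2 a, T a & N%:~R <= a.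
  apply: contrapT => noa; apply: Tunb; exists N%:~R => t Tt.
  rewrite leNgt; apply/negP => Nt; apply: noa.
  by exists t => //; rewrite ltW.
exists a => // s t Ts Tt as_ st; have Ns := le_trans Na as_.
have := Nray t t Tt Tt (lexx t) (le_trans Ns st).
have := Nray t s Tt Ts st Ns.
rewrite !mdist_graph_spaceE gdistxx add0r -natrD.
rewrite (gdist_sym (ray t) (ray s)).
set A := (_ + _)%N; set B := gdist _ _ => hA hB.
suff AB : A = B.
  by rewrite (gdist_sym (ray 0%R) (ray t)) (gdist_sym (ray 0%R)) addnC -/A AB.
by apply: (@eq_nat_dist_lt1 R); move: hA hB; rewrite !ltr_norml; lra.
Qed.

(** A ray tending to such a character would pass through a vertex [p] lying, for
    [U]-many [z], on minimal paths from [z] to both [x] and [y], so that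
    [z = p]; but [U] contains the complement of [p]. *)
Lemma separating_ultrafilter_not_Busemann (x y : X) (U : set_system X)
    (UU : UltraFilter U) :
  (forall u, U [set v | v != u]) -> U [set z | @only_between_at g z x y] ->
  ~ Busemann_point (ultrafilter_character UU).
Proof.
move=> Ufree Usep [_ [T [ray [ag cvw]]]].
have Tdom := ag.1; have PF := ray_domain_proper Tdom.
have [a Ta geo] := almost_geodesic_ray_eventually ag.
pose D := [set t | T t /\ a <= t].
have from_ray := @eventually_geodesic_from g R D ray (ray 0%R).
have geoD s t : D s -> D t -> s <= t ->
    (@gdist g (ray 0%R) (ray t) =
      gdist (ray 0%R) (ray s) + @gdist g (ray s) (ray t))%N.
  by move=> [Ts as_] [Tt _]; exact: geo.
have D0 : D !=set0 by exists a.
have [b [Tb ab] geox] := from_ray D0 geoD x.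
have [c [Tc ac] geoy] := from_ray D0 geoD y.
pose s := Num.max b c.
have [Ts as_] : D s by rewrite /s; case: (leP b c).
pose p := ray s.
(* Evaluate the function [v |-> d(v, u) - d(v, p)] at the character in two
   ways: along the ray, where it is eventually [d(u, p)], and along [U]. *)
have limit u d : D d -> d <= s ->
    (forall s t, D s -> D t -> d <= s -> s <= t ->
      (@gdist g u (ray t) = @gdist g u (ray s) + @gdist g (ray s) (ray t))%N) ->
    U [set z | @gdist g z u = (@gdist g z p + @gdist g p u)%N].
  move=> Dd ds geou; pose f : metric_alg X := SigSub (dist_diff_alg u p).
  have wf : ultrafilter_character UU f = ((@gdist g u p)%:R%:C)%C.
    rewrite -(norm_cvg_lim (@ray_converges_cvg _ _ _ _ _ f cvw Tdom)).
    apply: norm_cvg_lim; apply: cvg_near_cst; exists s.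
    split=> [|t st Tt]; first exact: num_real.
    rewrite /= /dist_diff !mdist_graph_spaceE.
    have Dt : D t by split => //; exact: le_trans as_ (ltW st).
    rewrite (gdist_sym (ray t) u) (geou s t) //; last exact: ltW.
    by rewrite (gdist_sym (ray t)) natrD addrK.
  have := @ultrafilter_character_cvg _ _ _ UU f; rewrite wf.
  move=> /cvgrPdist_lt /(_ 1 ltr01); apply: filterS => z /=.
  rewrite /dist_diff !mdist_graph_spaceE -rmorphB /=.
  rewrite norm_real_complex -[X in _ < X]/((1 : R)%:C%C) ltcR => lt1.
  rewrite addnC; apply/esym/(@eq_nat_dist_lt1 R).
  rewrite natrD; apply: le_lt_trans lt1; rewrite le_eqVlt; apply/orP; left.
  by apply/eqP; congr (`|_|); rewrite (gdist_sym p u); ring.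
have [z [[zx zy] [zp zsep]]] : exists z,
    ([set z | @gdist g z x = (@gdist g z p + @gdist g p x)%N] `&`
    [set z | @gdist g z y = (@gdist g z p + @gdist g p y)%N]) z /\
    ([set v | v != p] `&` [set z | @only_between_at g z x y]) z.
  apply: (@filter_ex _ U); apply: filterI; apply: filterI => //.
    by apply: limit geox => //; rewrite /s le_max lexx.
  by apply: limit geoy => //; rewrite /s le_max lexx orbT.
by move/eqP: zp; apply; rewrite (zsep p).
Qed.

Lemma exists_not_Busemann (x y : X) :
  (forall k : nat, exists z : X,
    (k < @gdist g x z)%N /\ @only_between_at g z x y) ->
  exists w : metric_compactification X, metric_boundary w /\ ~ Busemann_point w.
Proof.
move=> far.
pose B (k : nat) :=
  [set z : X | (k < @gdist g x z)%N /\ @only_between_at g z x y].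
have PF : ProperFilter (filter_from [set: nat] B).
  apply: filter_from_proper => [|k _]; last exact: far.
  apply: filter_from_filter => [|i j _ _]; first by exists 0%N.
  exists (maxn i j) => // z [kz zsep]; split; split=> //.
    exact: leq_ltn_trans (leq_maxl i j) kz.
  exact: leq_ltn_trans (leq_maxr i j) kz.
have [U [UU BU]] := ultraFilterLemma PF.
have Ufree u : U [set v | v != u].
  apply: BU; exists (@gdist g x u) => // z [uz _] /=.
  by apply: contraTneq uz => ->; rewrite ltnn.
exists (ultrafilter_character UU); split.
  exact: ultrafilter_character_boundary.
apply: (@separating_ultrafilter_not_Busemann x y) => //.
by apply: BU; exists 0%N => // z [].
Qed.

End GraphBoundary.

Local Close Scope ring_scope.
Local Close Scope classical_set_scope.

Theorem proposition3p3 (R : realType) (G : groupType) (S : {fset G})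
    (Sinv : S = [fset (s^-1)%g | s in S]%fset) (Sgen : generates S) :
  (exists n : nat, forall m : nat,
     exists x y z : cayley_graph Sinv Sgen,
       [/\ rigid_triple x y z, gdist x y = n & m < perimeter x y z]) ->
  exists w : metric_compactification (graph_space R (cayley_graph Sinv Sgen)),
    metric_boundary w /\ ~ Busemann_point w.
Proof.
move=> [n triples]; pose Gamma := cayley_graph Sinv Sgen.
pose e : Gamma := 1%g.
have far m : exists2 y : Gamma, gdist e y = n &
    exists z, (m < gdist e z)%N /\ only_between_at z e y.
  (* The perimeter is at most twice [d(x, y) + d(x, z)], whence the bound. *)
  have [x [y [z [[_ _ _ zrig] xy]]]] := triples (n + n + m + m)%N.
  have {}zrig := @only_between_at_mulg _ _ Sinv Sgen
    (x^-1)%g _ _ _ (rigid_corner_only_between zrig).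
  rewrite /perimeter => perim.
  exists (x^-1 * y)%g; first by rewrite -xy -(gdist_mulg (x^-1)%g x y) mulVg.
  exists (x^-1 * z)%g; split; last by move: zrig; rewrite mulVg.
  rewrite /e -(mulVg x) gdist_mulg.
  have := gdist_triangle x y z; have := gdist_sym z x.
  have := gdist_sym y x; lia.
(* Pigeonhole: if each vertex at distance [n] from [e] had its corners [z] at
   bounded distance, these finitely many bounds would contradict [far]. *)
have [s sP] := sphere_finite Sinv Sgen n.
suff [y yfar] : exists y : Gamma, forall m, exists z : Gamma,
    (m < gdist e z)%N /\ only_between_at z e y.
  exact: (@exists_not_Busemann R Gamma e y).
apply: contrapT => /forallNP noy.
have : exists M : nat, forall y : Gamma, y \in s -> forall z : Gamma,
    (M < gdist e z)%N -> ~ only_between_at z e y.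
  elim: s {sP} => [|y s [M MP]]; first by exists 0%N.
  have /existsNP[k kP] := noy y; exists (maxn k M) => y'.
  rewrite inE => /predU1P[->|y's] z; rewrite gtn_max => /andP[kz Mz].
    by move=> zsep; apply: kP; exists z.
  exact: MP y's z Mz.
move=> [M MP]; have [y yn [z [Mz zsep]]] := far M.
exact: MP (sP y yn) z Mz zsep.
Qed.
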